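(* In the setting described in the context (data $\Omega,\mathcal{U},f,\ell,C$), suppose that at least one of the following conditions is fulfilled: (i) $|\Omega|<+\infty$; (ii) $|\mathcal{U}|<+\infty$ and $C=C^\alpha$ for some $\alpha>m-1$; (iii) $\mathcal{U}=\mathcal{U}_1\times\dots\times\mathcal{U}_m$, where $\mathcal{U}_j\subseteq\mathbb{R}^{k_j}$ are such that $\sum_{j=1}^m k_j=k$, and for $u=(u^1,\dots,u^m)$ with $u^j\in\mathbb{R}^{k_j}$ one has $f(x,u)=(f_1(x,u^1),\dots,f_m(x,u^m))^\top$ (i.e. the $j$-th component of $f$ depends only on $x$ and $u^j$), and $C=C^\alpha$ for some $\alpha>m-1$. Then $(\mathcal{UP})$ satisfies the weakly efficient finite dimensional vectorization property (wFDVP), i.e. there exists some $p\in\mathbb{N}$ such that $\operatorname{wargmin}_x(\mathcal{MP}_p)=\operatorname{wargmin}(\mathcal{UP})$. Moreover, in case (i) one can choose $p=|\Omega|-1$, in case (ii) one can choose $p=m^{|\mathcal{U}|}$, and in case (iii) the choice $p=m$ is sufficient.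
   Context: Conventions: $\mathbb{N}=\{1,2,\dots\}$, $[p]=\{1,\dots,p\}$; $|\cdot|$ is cardinality; inequalities $\le$, $<$ between vectors are componentwise; $e$ is the all-ones vector of appropriate dimension; $\mathbb{R}^m_+$ is the nonnegative orthant; $\operatorname{Int}$, $\operatorname{cl}$, $(\cdot)^c$ are interior, closure, complement in $\mathbb{R}^m$. A cone $C$ (i.e. $\lambda\ge0$, $c\in C$ imply $\lambda c\in C$) is pointed if $C\cap(-C)=\{0\}$ and solid if $\operatorname{Int}C\neq\emptyset$. For $\alpha>m-1$, $C^\alpha:=\{y\in\mathbb{R}^m\mid M^\alpha y\le 0\}$, where $M^\alpha\in\mathbb{R}^{m\times m}$ has all diagonal entries equal to $-\alpha$ and all off-diagonal entries equal to $1$. Setting: $\Omega\subseteq\mathbb{R}^n$ and $\mathcal{U}\subseteq\mathbb{R}^k$ are nonempty and closed, $\mathcal{U}$ is compact, and $f:\Omega\times\mathcal{U}\to\mathbb{R}^m$ is continuous, with components $f_1,\dots,f_m$. $\ell\in\mathbb{R}^m$ is a vector and $C\subseteq(\operatorname{Int}\mathbb{R}^m_+)\cup\{0\}$ is a closed, convex, pointed, solid cone such that $f(\Omega\times\mathcal{U})\subseteq\{\ell\}+\operatorname{Int}C$. The uncertain multiobjective problem $(\mathcal{UP})$ is the parametric family of problems ''minimize $f(x,u)$ subject to $x\in\Omega$'', indexed by $u\in\mathcal{U}$. For $x\in\Omega$ put $F_{\mathcal{U}}(x):=\{f(x,u)\mid u\in\mathcal{U}\}$. The set $\operatorname{wargmin}(\mathcal{UP})$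 of robust weakly efficient solutions consists of all $\bar x\in\Omega$ for which there is no $x\in\Omega$ with $F_{\mathcal{U}}(x)\subseteq F_{\mathcal{U}}(\bar x)-\operatorname{Int}\mathbb{R}^m_+$. Let $\mathrm{ub}(x):=\big(\sup_{u\in\mathcal{U}}f_1(x,u),\dots,\sup_{u\in\mathcal{U}}f_m(x,u)\big)^\top+e$, $[y^1,y^2]_C:=(\{y^1\}+C)\cap(\{y^2\}-\mathbb{R}^m_+)$, and $F(x):=\operatorname{cl}\big((F_{\mathcal{U}}(x)-\mathbb{R}^m_+)^c\big)\cap[\ell,\mathrm{ub}(x)]_C$. For $p\in\mathbb{N}$, $(\mathcal{MP}_p)$ is the multiobjective problem of minimizing $(y^1,\dots,y^p)\in\mathbb{R}^{mp}$ over all $(x,y^1,\dots,y^p)\in\mathbb{R}^n\times(\mathbb{R}^m)^p$ with $x\in\Omega$, $y^i-\ell\in C$ for all $i\in[p]$, and $\min_{j\in[m]}\{f_j(x,u)-y^i_j\}\le 0$ for all $u\in\mathcal{U}$, $i\in[p]$. A feasible $(\bar x,\bar y^1,\dots,\bar y^p)$ is weakly efficient if there is no feasible $(x,y^1,\dots,y^p)$ with $y^i<\bar y^i$ for all $i\in[p]$; the set of these is $\operatorname{wargmin}(\mathcal{MP}_p)$. Its projection is $\operatorname{wargmin}_x(\mathcal{MP}_p):=\{x'\in\mathbb{R}^n\mid\exists\,y^1,\dots,y^p\in F(x'):(x',y^1,\dots,y^p)\in\operatorname{wargmin}(\mathcal{MP}_p)\}$.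
   Formalization: In case (i) the choice p = |Ω|−1 is asserted only for |Ω| ≥ 2, since for |Ω| = 1 it gives p = 0, which is not in ℕ and for which (MP_0) is undefined; the existence of some p ∈ ℕ is still proved for |Ω| = 1. *)

(* Defs.v *)
From HB Require Import structures.
From mathcomp Require Import all_boot all_order all_algebra.
From mathcomp Require Import finmap.
From mathcomp Require Import all_classical all_reals all_analysis.

Set Implicit Arguments.
Unset Strict Implicit.
Unset Printing Implicit Defensive.

Import Order.TTheory GRing.Theory Num.Theory.
Import numFieldNormedType.Exports.

Local Open Scope classical_set_scope.
Local Open Scope ring_scope.

Section Order.
Context {R : realType}.

Definition mxle {p q : nat} (A B : 'M[R]_(p, q)) : Prop :=
  forall i j, A i j <= B i j.

Definition mxlt {p q : nat} (A B : 'M[R]_(p, q)) : Prop :=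
  forall i j, A i j < B i j.

Definition orthant {m : nat} : set 'rV[R]_m := [set y | mxle 0 y].

Definition setadd {m : nat} (A B : set 'rV[R]_m) : set 'rV[R]_m :=
  [set a + b | a in A & b in B].

Definition setsub {m : nat} (A B : set 'rV[R]_m) : set 'rV[R]_m :=
  [set a - b | a in A & b in B].

End Order.

Section Cones.
Context {R : realType} {m : nat}.

Definition is_cone (C : set 'rV[R]_m) : Prop :=
  forall (a : R) (c : 'rV[R]_m), 0 <= a -> C c -> C (a *: c).

Definition pointed_cone (C : set 'rV[R]_m) : Prop :=
  C `&` [set - c | c in C] = [set 0].

Definition solid_cone (C : set 'rV[R]_m) : Prop := C° !=set0.

Definition mxalpha (alpha : R) : 'M[R]_m :=
  \matrix_(i, j) (if i == j then - alpha else 1).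

Definition cone_alpha (alpha : R) : set 'rV[R]_m :=
  [set y | mxle (mxalpha alpha *m y^T) 0].

End Cones.

Section Problems.
Context {R : realType} {n k m : nat}.
Variables (Omega : set 'rV[R]_n) (U : set 'rV[R]_k).
Variable f : 'rV[R]_n -> 'rV[R]_k -> 'rV[R]_m.
Variables (l : 'rV[R]_m) (C : set 'rV[R]_m).

Definition FU (x : 'rV[R]_n) : set 'rV[R]_m := [set f x u | u in U].

Definition wargmin_UP : set 'rV[R]_n :=
  [set xb | Omega xb /\
    ~ exists2 x, Omega x & FU x `<=` setsub (FU xb) (orthant°)].

Definition ub (x : 'rV[R]_n) : 'rV[R]_m :=
  \row_j sup [set f x u 0 j | u in U] + const_mx 1.

Definition box (y1 y2 : 'rV[R]_m) : set 'rV[R]_m :=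
  setadd [set y1] C `&` setsub [set y2] orthant.

Definition Fset (x : 'rV[R]_n) : set 'rV[R]_m :=
  closure (~` setsub (FU x) orthant) `&` box l (ub x).

(* The minimum over 'I_m is taken in the extended reals only to have a neutral
   element; for 0 < m it is the minimum of m real numbers. *)
Definition feasible_MP (p : nat) (x : 'rV[R]_n) (y : 'I_p -> 'rV[R]_m) : Prop :=
  [/\ Omega x,
      forall i, C (y i - l) &
      forall u, U u -> forall i,
        (\big[mine/+oo]_(j < m) (f x u 0 j - y i 0 j)%:E <= 0)%E].

Definition wargmin_MP (p : nat) : set ('rV[R]_n * ('I_p -> 'rV[R]_m)) :=
  [set z | feasible_MP z.1 z.2 /\
    ~ exists (x : 'rV[R]_n) (y : 'I_p -> 'rV[R]_m),
        feasible_MP x y /\ forall i, mxlt (y i) (z.2 i)].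

Arguments wargmin_MP : clear implicits.

Definition wargmin_x_MP (p : nat) : set 'rV[R]_n :=
  [set x | exists y : 'I_p -> 'rV[R]_m,
    (forall i, Fset x (y i)) /\ wargmin_MP p (x, y)].

Definition wFDVP : Prop :=
  exists p : nat, (0 < p)%N /\ wargmin_x_MP p = wargmin_UP.

Definition case_i : Prop := finite_set Omega.

Definition case_ii : Prop :=
  finite_set U /\ exists2 alpha : R, m%:R - 1 < alpha & C = cone_alpha alpha.

(* R^k is identified with R^(kj 0) x ... x R^(kj (m-1)) by cutting a row vector
   into consecutive blocks. *)
Definition block (kj : 'I_m -> nat) (hk : (\sum_(j < m) kj j)%N = k)
    (u : 'rV[R]_k) (j : 'I_m) : 'rV[R]_(kj j) :=
  submxrow (castmx (erefl 1%N, esym hk) u) j.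

Definition case_iii : Prop :=
  (exists (kj : 'I_m -> nat) (hk : (\sum_(j < m) kj j)%N = k)
          (Uj : forall j : 'I_m, set 'rV[R]_(kj j))
          (fj : forall j : 'I_m, 'rV[R]_n -> 'rV[R]_(kj j) -> R),
      U = [set u | forall j, Uj j (block hk u j)] /\
      forall x u, Omega x -> U u ->
        f x u = \row_j fj j x (block hk u j)) /\
  exists2 alpha : R, m%:R - 1 < alpha & C = cone_alpha alpha.

End Problems.

(* Main.v *)
Require Import Defs.
From HB Require Import structures.
From mathcomp Require Import all_boot all_order all_algebra.
From mathcomp Require Import finmap.
From mathcomp Require Import all_classical all_reals all_analysis.
Import Order.TTheory GRing.Theory Num.Theory.
Import numFieldNormedType.Exports.
Local Open Scope classical_set_scope.
Local Open Scope ring_scope.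
From mathcomp Require Import lra.

Set Implicit Arguments.
Unset Strict Implicit.
Unset Printing Implicit Defensive.

(** Write [down A] for the open set of the points strictly below some point of
[A].  The constraints of the vectorized problem say that each [y i] lies in
[l + C] and outside [down (FU x)] ([feasible_MPP]), and [x] is robustly weakly
efficient when every [x'] has a scenario [u] with [f x' u] outside
[down (FU x)].

Every weakly efficient point of the vectorized problem projects to a robustly
weakly efficient one, for each [p] ([wargmin_x_MP_sub]).  If [x'] beats [x],
meaning that [FU x'] is inside [down (FU x)], then compactness leaves a positive
gap between [FU x'] and the boundary of [down (FU x)].  So all the [y i] can be
moved slightly towards [l] and remain outside [down (FU x')].  They stay in
[l + C] because [C] is a cone, and they decrease strictly in every coordinate
because the nonzero elements of [C] are positive.

For the converse it suffices to find [p] points [z i] of [l + C], outside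
[down (FU x)], such that every competitor [x'] has a value [f x' u] above some
[z i] ([wargmin_x_MP_witness]).  Slide each [z i] along its segment to [l] until
it meets the boundary of [down (FU x)] ([boundary_point]).  The resulting [y i]
is below [f x' u], so no [y'] strictly below [y i] is feasible for [x'].  As
everything strictly below a boundary point is in [down (FU x)], none is feasible
for [x] either.  The slide also brings the point under [ub x], which puts it in
[Fset x].

The three cases differ in how the [z i] are found.
- For finitely many alternatives, take one good value [f x' u] for each [x']
  other than [x] ([vectorization_points]).
- For the cones [C^alpha], a point is outside [down (FU x)] exactly when each
  scenario [u] admits a coordinate [phi u] with [f x u <= y] there.  Fixing
  [phi] gives a region of [l + C^alpha] that has a least element, since
  [C^alpha] is stable under componentwise infima ([cone_alpha_inf]); these least
  elements are the [z i] ([vectorization_selectors]).  With finitely many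
  scenarios there are [m ^ #|U|] functions [phi].  With objective-wise
  uncertainty the [m] constant ones suffice, because scenarios that are bad for
  different coordinates can be glued into a single one. *)

(** * Points strictly below a set *)

Definition down {R : realType} {m : nat} (A : set 'rV[R]_m) : set 'rV[R]_m :=
  setsub A (orthant°).

Lemma near_right_ex {R : realType} (P : set R) :
  (\forall t \near (0 : R)^'+, P t) -> exists t, 0 < t /\ P t.
Proof.
move=> nP; have [t [t0 Pt]] := filter_ex (filterI (nbhs_right_gt (0 : R)) nP).
by exists t.
Qed.

Section Orthant.
Context {R : realType} {m : nat}.
Implicit Types (y z v l d : 'rV[R]_m) (A C : set 'rV[R]_m).

Lemma ray_cvg y v : (fun t : R => y + t *: v) @ 0^'+ --> y.
Proof.
have : (fun t : R => y + t *: v) @ 0^'+ --> y + 0 *: v.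
  apply: cvgD; first exact: cvg_cst.
  by apply: cvgZr_tmp; exact: cvg_at_right_filter.
by rewrite scale0r addr0.
Qed.

Lemma mxlt_near y z v : mxlt y z ->
  \forall t \near (0 : R)^'+, mxlt (y + t *: v) z.
Proof.
move=> yz; apply: filter_forall => i; apply: filter_forall => j.
have c : (fun t : R => (y + t *: v) i j) @ 0^'+ --> y i j.
  have := cvg_comp _ _ (@ray_cvg y v) (@coord_continuous _ _ _ i j y). exact.
exact: (cvgr_lt (y i j)).
Qed.

Lemma orthant_interiorP y : orthant° y <-> mxlt 0 y.
Proof.
split=> [/(ray_cvg (const_mx (-1))) oy|y0].
  have [t [t0 yt]] : exists t : R, 0 < t /\ orthant (y + t *: const_mx (-1)).
    exact: near_right_ex oy.
  move=> i j; have := yt i j; rewrite !mxE; lra.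
suff : \forall z \near y, forall j, 0 <= (z : 'rV[R]_m) 0 j.
  by apply: filterS => z z0 i j; rewrite mxE ord1.
apply: (@filter_forall _ _ (fun j (z : 'rV[R]_m) => 0 <= z 0 j) (nbhs y)) => j.
have := y0 0 j; rewrite mxE => y0'.
apply: (cvgr_ge (y 0 j)) => //; exact: coord_continuous.
Qed.

Lemma downP A y : down A y <-> exists2 a, A a & mxlt y a.
Proof.
split=> [[a Aa [b /orthant_interiorP b0 <-]]|[a Aa ya]].
  by exists a => // i j; have := b0 i j; rewrite !mxE; lra.
exists a => //; exists (a - y); last by rewrite opprB addrC subrK.
by apply/orthant_interiorP => i j; have := ya i j; rewrite !mxE; lra.
Qed.

Lemma down_le A y z : down A z -> mxle y z -> down A y.
Proof.
move=> /downP[a Aa za] yz; apply/downP; exists a => // i j.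
exact: le_lt_trans (za i j).
Qed.

(** Moving a little along [- (1, ..., 1)] stays in [C], hence in the closed
orthant. *)
Lemma cone_interior_pos C c : C `<=` orthant° `|` [set 0] -> C° c -> mxlt 0 c.
Proof.
move=> CO /(ray_cvg (const_mx (-1))) Cc.
have [t [t0 Ct]] : exists t : R, 0 < t /\ C (c + t *: const_mx (-1)).
    exact: near_right_ex Cc.
move=> i j; rewrite mxE; have [/orthant_interiorP|] := CO _ Ct.
  by move=> /(_ i j); rewrite !mxE; lra.
by move=> /(congr1 (fun y => y i j)); rewrite !mxE; lra.
Qed.

(** The exit parameter is the infimum of the parameters at which the segment
from [l] to [z] is outside [down A].  It is attained because [down A] is open,
and [down A] being downward closed makes the portion before it lie inside. *)
Lemma first_exit A l z : mxlt l z -> down A l -> ~ down A z ->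
  exists t : R, [/\ 0 <= t, t <= 1, ~ down A (l + t *: (z - l)) &
    forall y, mxlt y (l + t *: (z - l)) -> down A y].
Proof.
move=> lz Al nAz; pose T := [set t : R | 0 <= t /\ ~ down A (l + t *: (z - l))].
have T1 : T 1 by split=> //; rewrite scale1r addrC subrK.
have lbT : lbound T 0 by move=> t [].
have hT : has_lbound T by exists 0.
have mono s t : s <= t -> mxle (l + s *: (z - l)) (l + t *: (z - l)).
  move=> st i j; have := lz i j; rewrite !mxE => lzij.
  by rewrite lerD2l ler_wpM2r // subr_ge0 ltW.
exists (inf T); split.
- by apply: lb_le_inf => //; exists 1.
- exact: ge_inf.
- move=> /downP[a Aa /(mxlt_near (z - l)) na].
  have [e [e0 ea]] : exists e : R, 0 < e /\
      mxlt (l + inf T *: (z - l) + e *: (z - l)) a.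
    exact: near_right_ex na.
  have [||s [s0 +] sT] := @inf_lt _ T (inf T + e).
  + by exists 1.
  + by rewrite ltrDl.
  apply; apply/downP; exists a => // i j; apply: le_lt_trans (ea i j).
  rewrite -addrA -scalerDl; exact/mono/ltW.
- move=> y /(mxlt_near (z - l)) ny.
  have [e [e0 ea]] : exists e : R, 0 < e /\
      mxlt (y + e *: (z - l)) (l + inf T *: (z - l)).
    exact: near_right_ex ny.
  have ye : mxle y (l + (inf T - e) *: (z - l)).
    by move=> i j; have := ea i j; rewrite !mxE; lra.
  apply: down_le ye; have [t0|t0] := ltP (inf T - e) 0.
    apply: down_le Al _; have := mono _ _ (ltW t0).
    by rewrite scale0r addr0.
  apply: contrapT => nd.
  have : inf T <= inf T - e by apply: ge_inf.
  by rewrite lerBrDl gerDr leNgt e0.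
Qed.

(** This is where compactness of the value sets enters.  Each [z] in [K] has a
coordinate in which it is strictly below [y]; the same coordinate keeps working
for nearby [z] and small [t], and a near-covering argument makes [t] uniform. *)
Lemma compact_shrink (K : set 'rV[R]_m) A y c : compact K -> K `<=` down A ->
  ~ down A y -> \forall t \near (0 : R)^'+, ~ down K (y - t *: c).
Proof.
move=> /compact_near_coveringP cK KA nAy.
have : \forall t \near (0 : R)^'+,
    K `<=` (fun z => exists j, z 0 j + t * c 0 j < y 0 j).
  apply: cK => z /KA /downP[a Aa za].
  have [j ay] : exists j, a 0 j <= y 0 j.
    apply: contrapT => /forallNP nay; apply: nAy; apply/downP; exists a => //.
    by move=> i j; rewrite ord1 ltNge; apply/negP.
  have zy : z 0 j < y 0 j by exact: lt_le_trans (za 0 j) ay.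
  pose b := (z 0 j + y 0 j) / 2.
  have nz : \forall z' \near z, (z' : 'rV[R]_m) 0 j < b.
    have /cvgr_lt := @coord_continuous R 1 m 0 j z; apply; rewrite /b; lra.
  have nt : \forall t \near (0 : R)^'+, t * c 0 j < y 0 j - b.
    apply: (cvgr_lt (0 * c 0 j)); last by rewrite /b; lra.
    by apply: cvgM; [exact: cvg_at_right_filter | exact: cvg_cst].
  exists ([set z' : 'rV[R]_m | z' 0 j < b], [set t : R | t * c 0 j < y 0 j - b]).
    by split.
  by move=> [z' t] /= [z'b tb]; exists j; lra.
apply: filterS => t Kt /downP[a /Kt[j aj] /(_ 0 j)]; rewrite !mxE; lra.
Qed.

End Orthant.

(** * Least elements in the cones [C^alpha] *)

Section ConeAlpha.
Context {R : realType} {m : nat}.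
Implicit Types (y l : 'rV[R]_m) (S : set 'rV[R]_m).

Lemma cone_alphaP alpha y : cone_alpha alpha y <->
  forall j, \sum_i y 0 i <= (alpha + 1) * y 0 j.
Proof.
have E j : (mxalpha alpha *m y^T) j 0 = \sum_i y 0 i - (alpha + 1) * y 0 j.
  rewrite mxE (bigD1 j) //= [in RHS](bigD1 j) //= !mxE eqxx.
  rewrite (eq_bigr (fun i => y 0 i)); last first.
    by move=> i ij; rewrite !mxE eq_sym (negPf ij) mul1r.
  lra.
split=> [H j|H j a]; last by rewrite ord1 E mxE subr_le0.
by have := H j 0; rewrite E mxE subr_le0.
Qed.

(** The inequalities of [cone_alphaP] bound one coordinate from below by an
increasing function of all of them, so they pass to componentwise infima.  The
last clause says that the infimum also inherits every coordinatewise lower bound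
of [S]; hence it belongs to [S] when [S] is cut out of the translated cone by
such bounds. *)
Lemma cone_alpha_inf alpha l S : -1 < alpha -> S !=set0 ->
  (forall y, S y -> cone_alpha alpha (y - l) /\ mxle l y) ->
  exists g, [/\ cone_alpha alpha (g - l), forall y, S y -> mxle g y &
    forall a j, (forall y, S y -> a <= y 0 j) -> a <= g 0 j].
Proof.
move=> a1 [y0 Sy0] SP; pose g : 'rV[R]_m := \row_j inf [set y 0 j | y in S].
have gle y : S y -> mxle g y.
  move=> Sy i j; rewrite ord1 mxE; apply: ge_inf; last by exists y.
  by exists (l 0 j) => _ [w /SP[_ lw] <-].
have leg a j : (forall y, S y -> a <= y 0 j) -> a <= g 0 j.
  move=> aS; rewrite mxE; apply: lb_le_inf; first by exists (y0 0 j), y0.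
  by move=> _ [w Sw <-]; exact: aS.
exists g; split=> //; apply/cone_alphaP => j.
have a0 : 0 < alpha + 1 by lra.
rewrite [(g - l) 0 j]mxE [(- l) 0 j]mxE -ler_pdivrMl // lerBrDr; apply: leg => y Sy.
rewrite -lerBrDr ler_pdivrMl //.
have [/cone_alphaP/(_ j) + _] := SP y Sy; rewrite [(y - l) 0 j]mxE [(- l) 0 j]mxE.
apply: le_trans; apply: ler_sum => i _.
by rewrite !mxE lerD2r; have := gle y Sy 0 i; rewrite mxE.
Qed.

End ConeAlpha.
(** * Robust efficiency and the vectorized problem *)

Section Vectorization.
Context {R : realType} {n k m : nat}.
Context (Omega : set 'rV[R]_n) (U : set 'rV[R]_k).
Context (f : 'rV[R]_n -> 'rV[R]_k -> 'rV[R]_m).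
Context (l : 'rV[R]_m) (C : set 'rV[R]_m).
Hypothesis U_neq0 : U !=set0.
Hypothesis U_compact : compact U.
Hypothesis f_cont : {within Omega `*` U, continuous (fun z => f z.1 z.2)}.
Hypothesis C_sub : C `<=` orthant° `|` [set 0].
Hypothesis C_cone : is_cone C.
Hypothesis f_sub : [set f x u | x in Omega & u in U] `<=` setadd [set l] (C°).

Lemma value_cone x u : Omega x -> U u -> C (f x u - l) /\ mxlt l (f x u).
Proof.
move=> Ox Uu; have [_ -> [c Cc <-]] : setadd [set l] (C°) (f x u).
  by apply: f_sub; exists x => //; exists u.
rewrite addrC addKr; split; first exact: interior_subset.
by move=> i j; have := cone_interior_pos C_sub Cc i j; rewrite !mxE; lra.
Qed.

Lemma l_down x : Omega x -> down (FU U f x) l.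
Proof.
move=> Ox; have [u Uu] := U_neq0; apply/downP; exists (f x u); first by exists u.
exact: (value_cone Ox Uu).2.
Qed.

Lemma FU_compact x : Omega x -> compact (FU U f x).
Proof.
move=> Ox; have -> : FU U f x = (fun z => f z.1 z.2) @` ([set x] `*` U).
  apply/seteqP; split=> [_ [u Uu <-]|_ [[_ u] [/= -> Uu] <-]]; last by exists u.
  by exists (x, u).
apply: continuous_compact; last exact: compact_setX (@compact_set1 _ x) U_compact.
by apply: continuous_subspaceW f_cont => -[_ u] [/= -> Uu].
Qed.

Lemma le_sup_FU x u j : Omega x -> U u -> f x u 0 j <= sup [set f x u 0 j | u in U].
Proof.
move=> Ox Uu; apply: ub_le_sup; last by exists u.
have : compact ((fun z : 'rV[R]_m => z 0 j) @` FU U f x).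
  apply: continuous_compact (FU_compact Ox).
  by apply: continuous_subspaceT => z; exact: coord_continuous.
rewrite /FU image_comp => K.
by have [] := compact_has_sup (image_nonempty _ U_neq0) K.
Qed.

Lemma feasible_MPP p x (y : 'I_p -> 'rV[R]_m) : feasible_MP Omega U f l C x y <->
  [/\ Omega x, forall i, C (y i - l) & forall i, ~ down (FU U f x) (y i)].
Proof.
split=> -[Ox Cy H]; split=> //.
  move=> i /downP[_ [u Uu <-] yu].
  have /bigmin_leP[//|[j _]] := H u Uu i.
  by rewrite lee_fin subr_le0 leNgt yu.
move=> u Uu i; apply/bigmin_leP; right; apply: contrapT => nj; apply: (H i).
apply/downP; exists (f x u); first by exists u.
move=> a j; rewrite ord1 ltNge; apply/negP => fy; apply: nj; exists j => //.
by rewrite lee_fin subr_le0.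
Qed.

Lemma cone_pos x y : Omega x -> C (y - l) -> ~ down (FU U f x) y -> mxlt l y.
Proof.
move=> Ox /C_sub[/orthant_interiorP y0 _ i j|/eqP].
  by have := y0 i j; rewrite !mxE subr_gt0.
by rewrite subr_eq0 => /eqP -> []; exact: l_down.
Qed.

(** A robust improvement [x'] of [x] would allow all the [y i] to be scaled
towards [l] at once. *)
Lemma wargmin_x_MP_sub p : wargmin_x_MP Omega U f l C p `<=` wargmin_UP Omega U f.
Proof.
move=> x [y [_ [/feasible_MPP[/= Ox Cy ny] yopt]]]; split=> // -[x' Ox' x'x].
apply: yopt => /=.
have ntx : \forall t \near (0 : R)^'+,
    forall i, ~ down (FU U f x') (y i - t *: (y i - l)).
  apply: filter_forall => i.
  exact: (compact_shrink (y i - l) (FU_compact Ox') x'x (ny i)).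
have [t [t0 [t1 nt]]] := near_right_ex (filterI (nbhs_right_lt ltr01) ntx).
exists x', (fun i => y i - t *: (y i - l)); split.
  apply/feasible_MPP; split=> // i.
  rewrite addrAC -{1}[y i - l]scale1r -scalerBl; apply: C_cone => //.
  by rewrite subr_ge0 ltW.
move=> i a j; have := cone_pos Ox (Cy i) (ny i) a j; rewrite !mxE => lt_l.
by rewrite ltrBlDr ltrDl mulr_gt0 // subr_gt0.
Qed.

(** Any feasible [z] can be lowered to a point of the bounding box below which
nothing is feasible for [x]. *)
Lemma boundary_point x z : Omega x -> C (z - l) -> ~ down (FU U f x) z ->
  exists y, [/\ Fset U f l C x y, C (y - l), ~ down (FU U f x) y,
    mxle y z & forall y', mxlt y' y -> down (FU U f x) y'].
Proof.
move=> Ox Cz nz; have lz := cone_pos Ox Cz nz.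
have [t [t0 t1 nd md]] := first_exit lz (l_down Ox) nz.
set y := l + t *: (z - l) in nd md.
have Cy : C (y - l) by rewrite /y addrC addKr; exact: C_cone.
exists y; split=> //; last first.
  move=> i j; have := lz i j; rewrite !mxE => lzij.
  by rewrite -lerBrDl ger_pMl // subr_gt0.
split.
  (* The closure is the complement of an interior; were [y] interior to
     [FU x - orthant], a step upwards would put [y] strictly below a value. *)
  rewrite closure_setC => /(ray_cvg (const_mx 1)) oy.
  have [e [e0 [a Aa [b b0 be]]]] := near_right_ex oy; apply: nd; apply/downP.
  exists a => // i j; have := b0 i j.
  by move/(congr1 (fun w : 'rV[R]_m => w i j)): be; rewrite !mxE; lra.
split; first by exists l => //; exists (y - l) => //; rewrite addrC subrK.
exists (ub U f x) => //; exists (ub U f x - y); last by rewrite opprB addrC subrK.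
(* The summand [1] in [ub] absorbs the gap: [y - 1] is already below a value. *)
have /downP[_ [u Uu <-] yu] : down (FU U f x) (y - const_mx 1).
  by apply: md => i j; rewrite !mxE ltrBlDr ltrDl.
move=> i j; have := yu i j; have := le_sup_FU j Ox Uu.
by rewrite !mxE ord1; lra.
Qed.

(** The competitors [x' <> x] are blocked by the [z i], and [x] blocks itself
because the [z i], of which there is at least one, are lowered to boundary
points. *)
Lemma wargmin_x_MP_witness p x (z : 'I_p -> 'rV[R]_m) : (0 < p)%N -> Omega x ->
  (forall i, C (z i - l) /\ ~ down (FU U f x) (z i)) ->
  (forall x', Omega x' -> x' <> x ->
    exists i, exists2 u, U u & mxle (z i) (f x' u)) ->
  wargmin_x_MP Omega U f l C p x.
Proof.
move=> p0 Ox zP zdom.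
have /choice[y yP] : forall i, exists y, [/\ Fset U f l C x y, C (y - l),
    ~ down (FU U f x) y, mxle y (z i) &
    forall y', mxlt y' y -> down (FU U f x) y'].
  by move=> i; have [Cz nz] := zP i; exact: boundary_point.
exists y; split; first by move=> i; case: (yP i).
split=> [|[x' [y' [/feasible_MPP[/= Ox' Cy' ny'] y'y]]]].
  by apply/feasible_MPP; split=> // i; case: (yP i).
have [E|/(zdom _ Ox')[i [u Uu zu]]] := pselect (x' = x).
  rewrite E in ny'; pose i := Ordinal p0; apply: (ny' i).
  by have [_ _ _ _] := yP i; apply; exact: y'y.
apply: (ny' i); apply/downP; exists (f x' u); first by exists u.
move=> a j; apply: lt_le_trans (y'y i a j) _.
by have [_ _ _ yz _] := yP i; exact: le_trans (yz a j) (zu a j).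
Qed.

Lemma wargmin_UP_escape x x' : wargmin_UP Omega U f x -> Omega x' ->
  exists2 u, U u & C (f x' u - l) /\ ~ down (FU U f x) (f x' u).
Proof.
move=> [Ox nx] Ox'; apply: contrapT => nu; apply: nx; exists x' => //.
move=> _ [u Uu <-]; apply: contrapT => nd; apply: nu; exists u => //.
by split=> //; exact: (value_cone Ox' Uu).1.
Qed.

(** Each alternative other than [x] is blocked by one of its own values. *)
Lemma vectorization_points p : finite_set Omega -> (0 < p)%N ->
  (#|` fset_set Omega| - 1 <= p)%N ->
  wargmin_x_MP Omega U f l C p = wargmin_UP Omega U f.
Proof.
move=> finO p0 cardp; apply/seteqP; split; first exact: wargmin_x_MP_sub.
move=> x xopt; have [Ox _] := xopt.
pose D := (fset_set Omega `\ x)%fset; pose e (i : 'I_p) := nth x D i.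
have inO x' : (x' \in fset_set Omega) = (x' \in Omega) by rewrite in_fset_set.
have cardD : (#|` D| <= p)%N.
  by move: cardp; rewrite (cardfsD1 x) inO mem_set // addKn.
have eP x' : Omega x' -> x' <> x -> exists i, e i = x'.
  move=> Ox' /eqP x'x; have x'D : x' \in D by rewrite in_fsetD1 x'x inO mem_set.
  have ltp : (index x' D < p)%N by apply: leq_trans cardD; rewrite index_mem.
  by exists (Ordinal ltp); rewrite /e nth_index.
(* Indices [i >= #|D|] have [e i = x], whose own values are feasible too. *)
have /choice[z zP] : forall i, exists z, (C (z - l) /\ ~ down (FU U f x) z) /\
    (Omega (e i) -> exists2 u, U u & mxle z (f (e i) u)).
  move=> i; have [Oe|nOe] := pselect (Omega (e i)).
    have [u Uu uP] := wargmin_UP_escape xopt Oe.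
    by exists (f (e i) u); split=> // _; exists u => // a j; exact: lexx.
  by have [u _ uP] := wargmin_UP_escape xopt Ox; exists (f x u); split.
apply: (@wargmin_x_MP_witness _ _ z) => // [i|x' Ox' /(eP _ Ox')[i ei]].
  by case: (zP i).
by exists i; rewrite -ei; apply: (zP i).2; rewrite ei.
Qed.

(** The family [phi] of coordinate selectors covers the feasible region of every
[x] by finitely many pieces, each with a least element.  Lower bounds for [x']
come from those pieces that contain a value [f x' u]. *)
Lemma vectorization_selectors alpha p (phi : 'I_p -> 'rV[R]_k -> 'I_m) :
  -1 < alpha -> C = cone_alpha alpha -> (0 < p)%N ->
  (forall x y, Omega x -> ~ down (FU U f x) y ->
    exists i, forall u, U u -> f x u 0 (phi i u) <= y 0 (phi i u)) ->
  wargmin_x_MP Omega U f l C p = wargmin_UP Omega U f.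
Proof.
move=> a1 CE p0 phiP; apply/seteqP; split; first exact: wargmin_x_MP_sub.
move=> x xopt; have [Ox _] := xopt.
pose S i := [set y | C (y - l) /\
  forall u, U u -> f x u 0 (phi i u) <= y 0 (phi i u)].
have /choice[z zP] : forall i, exists z, (C (z - l) /\ ~ down (FU U f x) z) /\
    forall y, S i y -> mxle z y.
  (* An empty piece blocks no competitor, so any feasible point will do. *)
  move=> i; have [S0|nS] := pselect (S i !=set0); last first.
    have [u _ uP] := wargmin_UP_escape xopt Ox; exists (f x u); split=> // y Sy.
    by case: nS; exists y.
  have [|g [Cg gle leg]] := cone_alpha_inf (l := l) a1 S0.
    move=> y [Cy _]; split; first by rewrite -CE.
    have [/interior_subset y0 a j|/eqP] := C_sub Cy.
      by have := y0 a j; rewrite !mxE subr_ge0.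
    by rewrite subr_eq0 => /eqP -> a j.
  exists g; split=> //; split; first by rewrite CE.
  move=> /downP[_ [u Uu <-] /(_ 0 (phi i u))]; apply/negP; rewrite -leNgt.
  by apply: leg => y [_]; exact.
apply: (@wargmin_x_MP_witness _ _ z) => // [i|x' Ox' _]; first by case: (zP i).
have [u Uu [Cu nu]] := wargmin_UP_escape xopt Ox'.
have [i iP] := phiP _ _ Ox nu; exists i; exists u => //.
by apply: (zP i).2; split.
Qed.

Lemma vectorization_finite_uncertainty alpha : (0 < m)%N -> finite_set U ->
  -1 < alpha -> C = cone_alpha alpha ->
  wargmin_x_MP Omega U f l C (m ^ #|` fset_set U|) = wargmin_UP Omega U f.
Proof.
move=> m0 finU a1 CE; pose T := {ffun fset_set U -> 'I_m}.
have <- : #|{: T}| = (m ^ #|` fset_set U|)%N by rewrite card_ffun card_ord cardfE.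
pose j0 := Ordinal m0.
pose phi (i : 'I_#|{: T}|) u :=
  if insub u is Some v then enum_val i v else j0.
apply: (@vectorization_selectors alpha _ phi) => //.
  by apply/card_gt0P; exists [ffun=> j0].
move=> x y Ox ny.
have /choice[s sP] : forall v : fset_set U,
    exists j, f x (fsval v) 0 j <= y 0 j.
  move=> v; apply: contrapT => /forallNP nj; apply: ny; apply/downP.
  have := fsvalP v; rewrite in_fset_set // inE => Uv.
  exists (f x (fsval v)); first by exists (fsval v).
  by move=> i j; rewrite ord1 ltNge; apply/negP.
exists (enum_rank [ffun v => s v]) => u Uu.
have uU : u \in fset_set U by rewrite in_fset_set // mem_set.
by rewrite /phi insubT enum_rankK ffunE; exact: (sP [` uU]%fset).
Qed.

(** If for each coordinate [j] some scenario [v j] put [f x (v j)] above [y] in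
that coordinate, the scenario whose [j]-th block is that of [v j] would put all
of [f x u] above [y].  So a feasible [y] dominates [f x] in one fixed coordinate
for all scenarios. *)
Lemma vectorization_objectivewise alpha (kj : 'I_m -> nat)
    (hk : (\sum_(j < m) kj j)%N = k)
    (Uj : forall j : 'I_m, set 'rV[R]_(kj j))
    (fj : forall j : 'I_m, 'rV[R]_n -> 'rV[R]_(kj j) -> R) :
  (0 < m)%N -> U = [set u | forall j, Uj j (block hk u j)] ->
  (forall x u, Omega x -> U u -> f x u = \row_j fj j x (block hk u j)) ->
  -1 < alpha -> C = cone_alpha alpha ->
  wargmin_x_MP Omega U f l C m = wargmin_UP Omega U f.
Proof.
move=> m0 UE fE a1 CE.
apply: (@vectorization_selectors alpha m (fun j _ => j)) => // x y Ox ny.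
apply: contrapT => /forallNP nj; apply: ny; apply/downP.
have /choice[v vP] : forall j, exists u, U u /\ y 0 j < f x u 0 j.
  move=> j; apply: contrapT => /forallNP nu; apply: (nj j) => u Uu.
  by rewrite leNgt; apply/negP => yf; apply: (nu u).
pose u : 'rV[R]_k := castmx (erefl 1%N, hk) (\mxrow_j block hk (v j) j).
have bu j : block hk u j = block hk (v j) j.
  by rewrite {1}/block /u (castmxK (erefl 1%N) hk) mxrowK.
have Uu : U u.
  by rewrite UE => j; rewrite bu; have [+ _] := vP j; rewrite {1}UE; apply.
exists (f x u); first by exists u.
move=> i j; have [Uv yv] := vP j; rewrite ord1 (lt_le_trans yv) //.
by rewrite !fE // !mxE bu.
Qed.

End Vectorization.

Theorem theorem4p17 (R : realType) (n k m : nat)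
    (Omega : set 'rV[R]_n) (U : set 'rV[R]_k)
    (f : 'rV[R]_n -> 'rV[R]_k -> 'rV[R]_m)
    (l : 'rV[R]_m) (C : set 'rV[R]_m) :
  (0 < n)%N -> (0 < k)%N -> (0 < m)%N ->
  Omega !=set0 -> closed Omega ->
  U !=set0 -> closed U -> compact U ->
  {within Omega `*` U, continuous (fun z => f z.1 z.2)} ->
  C `<=` orthant° `|` [set 0] ->
  closed C -> convex_set C -> is_cone C -> pointed_cone C -> solid_cone C ->
  [set f x u | x in Omega & u in U] `<=` setadd [set l] (C°) ->
  case_i Omega \/ case_ii U C \/ case_iii Omega U f C ->
  [/\ wFDVP Omega U f l C,
      case_i Omega -> (1 < #|` fset_set Omega|)%N ->
        wargmin_x_MP Omega U f l C (#|` fset_set Omega| - 1) = wargmin_UP Omega U f,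
      case_ii U C ->
        wargmin_x_MP Omega U f l C (m ^ #|` fset_set U|) = wargmin_UP Omega U f &
      case_iii Omega U f C ->
        wargmin_x_MP Omega U f l C m = wargmin_UP Omega U f].
Proof.
  (* your proof *)
Proof.
move=> n0 k0 m0 O0 _ U0 _ Uc fc CO _ _ Cc _ _ fs cases.
have ai p : case_i Omega -> (0 < p)%N -> (#|` fset_set Omega| - 1 <= p)%N ->
    wargmin_x_MP Omega U f l C p = wargmin_UP Omega U f.
  by move=> finO; exact: (vectorization_points U0 Uc fc CO Cc fs).
have gtN1 (alpha : R) : m%:R - 1 < alpha -> -1 < alpha.
  by apply: le_lt_trans; rewrite lerDr ler0n.
have aii : case_ii U C ->
    wargmin_x_MP Omega U f l C (m ^ #|` fset_set U|) = wargmin_UP Omega U f.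
  move=> [finU [alpha /gtN1 a1 CE]].
  exact: (vectorization_finite_uncertainty U0 Uc fc CO Cc fs m0 finU a1 CE).
have aiii : case_iii Omega U f C ->
    wargmin_x_MP Omega U f l C m = wargmin_UP Omega U f.
  move=> [[kj [hk [Uj [fj [UE fE]]]]] [alpha /gtN1 a1 CE]].
  exact: (vectorization_objectivewise U0 Uc fc CO Cc fs m0 UE fE a1 CE).
split=> //; last by move=> ci c1; apply: ai => //; rewrite subn_gt0.
case: cases => [ci|[cii|ciii]].
- exists #|` fset_set Omega|.+1; split=> //; apply: ai => //.
  exact: leq_trans (leq_subr _ _) (leqnSn _).
- by exists (m ^ #|` fset_set U|)%N; split; [rewrite expn_gt0 m0 | exact: aii].
- by exists m; split=> //; exact: aiii.
Qed.
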